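(* For every finite connected $(v_3)$ graph $G$ there is a finite sequence $G=G_0,G_1,\dots,G_k$ ($k\ge 0$) of connected $(v_3)$ graphs such that each $G_{i+1}$ is obtained from $G_i$ by a reduction (by some black vertex and some white vertex of $G_i$), and $G_k$ is isomorphic either to the Heawood graph or to the Pappus graph.
   Context: A $(v_3)$ graph is a finite simple bipartite cubic (3-regular) graph of girth at least $6$; its two colour classes are called black and white. Reduction of a bipartite cubic graph $G$ by a black vertex $u$ and a white vertex $v$: delete $u$ and $v$ and join their remaining neighbours so that the result is again cubic and bipartite. Precisely, if $u$ and $v$ are non-adjacent, $u$ has white neighbours $a_1,a_2,a_3$ and $v$ has black neighbours $b_1,b_2,b_3$, and one adds the three edges of a perfect matching between $\{a_1,a_2,a_3\}$ and $\{b_1,b_2,b_3\}$; if $u$ and $v$ are adjacent, $u$ has further neighbours $a_1,a_2$ and $v$ has further neighbours $b_1,b_2$, and one adds the two edges of a perfect matching between $\{a_1,a_2\}$ and $\{b_1,b_2\}$. The Heawood graph is the incidence graph of the Fano plane (14 vertices; LCF notation $[5,-5]^7$). The Pappus graph is the incidence graph of the Pappus $(9_3)$ configuration (18 vertices; LCF notation $[5,7,-7,7,-7,-5]^3$). *)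

(* Defs.v *)
From mathcomp Require Import all_boot.
Set Implicit Arguments. Unset Strict Implicit. Unset Printing Implicit Defensive.

(* A finite graph with a 2-colouring: colour [true] = black, [false] = white. *)
Record cgraph := CGraph {
  cV :> finType;
  cadj : rel cV;
  ccol : cV -> bool }.

Definition simple_graph (V : finType) (e : rel V) : Prop :=
  (forall x y, e x y = e y x) /\ (forall x, ~~ e x x).

Definition cubic (V : finType) (e : rel V) : Prop :=
  forall x : V, #|[set y | e x y]| = 3.

Definition girth_ge6 (V : finType) (e : rel V) : Prop :=
  forall c : seq V, uniq c -> cycle e c -> 3 <= size c -> 6 <= size c.

Definition v3 (G : cgraph) : Prop :=
  [/\ simple_graph (@cadj G),
      (forall x y : G, cadj x y -> ccol x != ccol y),
      cubic (@cadj G) & girth_ge6 (@cadj G)].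

Definition gconnected (G : cgraph) : Prop :=
  0 < #|G| /\ forall x y : G, connect (@cadj G) x y.

(* The graph G' is obtained from G by reduction by black u and white v:
   m is a perfect matching (bijection) from N(u)\{v} onto N(v)\{u};
   G' is (a copy of) the graph on V(G)\{u,v} with the old edges plus the
   matching edges, with inherited colours. *)
Definition red_added (G : cgraph) (u v : G) (m : G -> G) (x y : G) : bool :=
  [&& cadj u x, x != v & m x == y].

Definition reduction_step (G G' : cgraph) : Prop :=
  exists (u v : G) (m : G -> G),
    [/\ ccol u /\ ~~ ccol v,
        (forall a, cadj u a -> a != v -> cadj v (m a) /\ m a != u),
        (forall a b, cadj u a -> a != v -> cadj u b -> b != v ->
                      m a = m b -> a = b),
        (forall b, cadj v b -> b != u -> exists a, [/\ cadj u a, a != v & m a = b]) &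
    (exists f : G' -> G,
      [/\ injective f,
          (forall x, f x != u /\ f x != v),
          (forall y, y != u -> y != v -> exists x, f x = y),
          (forall x y, cadj x y = [|| cadj (f x) (f y), red_added u v m (f x) (f y)
                                    | red_added u v m (f y) (f x)]) &
          (forall x, ccol x = ccol (f x))])].

(* chain G = G_0, ..., G_k = H of connected (v_3) graphs, each a reduction
   of the previous (G_0 itself is assumed connected (v_3) separately) *)
Inductive reduces_to : cgraph -> cgraph -> Prop :=
  | red_refl G : reduces_to G G
  | red_step G G' H : reduction_step G G' -> v3 G' -> gconnected G' ->
      reduces_to G' H -> reduces_to G H.

(* graphs given by LCF notation on Z_n: vertex i is joined to i+1 and to
   i + off i (mod n), where off i is the LCF jump taken modulo n *)
Definition lcf_adj (n : nat) (off : nat -> nat) : rel 'I_n :=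
  fun i j =>
    [|| (j == (i + 1) %% n :> nat), (i == (j + 1) %% n :> nat),
        (j == (i + off i) %% n :> nat) | (i == (j + off j) %% n :> nat)].

(* Heawood graph: LCF [5,-5]^7 on 14 vertices *)
Definition heawood_adj : rel 'I_14 :=
  @lcf_adj 14 (fun i => if odd i then 9 else 5).

(* Pappus graph: LCF [5,7,-7,7,-7,-5]^3 on 18 vertices *)
Definition pappus_off (i : nat) : nat :=
  match i %% 6 with
  | 0 => 5 | 1 => 7 | 2 => 11 | 3 => 7 | 4 => 11 | _ => 13 end.
Definition pappus_adj : rel 'I_18 := @lcf_adj 18 pappus_off.

Definition isomorphic_to (G : cgraph) (n : nat) (e : rel 'I_n) : Prop :=
  exists f : G -> 'I_n, bijective f /\ forall x y, cadj x y = e (f x) (f y).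

(* Main.v *)
(** Suppose that no reduction of [G] yields a connected (v_3) graph. Counting the edges
that leave a vertex set at its black and at its white vertices modulo 3 shows that [G] has
no bridge, and a 2-edge cut would allow a reduction by two of its ends. Without 2-edge cuts
every reduction is connected, so every reduction of [G] must create a double edge or a
square. This is a local condition: whatever [u], [v] and the perfect matching between their
neighbourhoods, either some matched [a], [b] are joined by a path [a x y b] avoiding [u] and
[v], or two matched pairs [a, b] and [a', b'] satisfy [a ~ b'] and [a' ~ b]. Growing a finite
piece of [G] from one vertex, and branching over the possible new neighbours of a vertex and
over the possible paths [a x y b], gives a finite search tree whose only leaves that are not
contradictory contain the Heawood or the Pappus graph. *)
Require Import Defs.
From mathcomp Require Import all_boot.
From Stdlib Require Import Classical.

Set Implicit Arguments. Unset Strict Implicit. Unset Printing Implicit Defensive.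

(** * Bipartite graphs *)

Definition nbhd (V : finType) (e : rel V) (x : V) : {set V} := [set y | e x y].

Definition square_free (V : finType) (e : rel V) : Prop :=
  forall x a y b, x != y -> e x a -> e a y -> e y b -> e b x -> a = b.

Definition boundary (V : finType) (e : rel V) (S : {set V}) : {set V * V} :=
  [set p | [&& p.1 \in S, p.2 \notin S & e p.1 p.2]].

Lemma in_boundary (V : finType) (e : rel V) (S : {set V}) x y :
  ((x, y) \in boundary e S) = [&& x \in S, y \notin S & e x y].
Proof. by rewrite inE. Qed.

Section Bipartite.
Variables (V : finType) (e : rel V) (col : V -> bool).
Hypotheses (e_sym : symmetric e) (e_col : forall x y, e x y -> col y = ~~ col x).

Lemma bipartite_adj_neq x y : e x y -> x != y.
Proof. by move/e_col; apply: contra_eqN => /eqP->; case: (col y). Qed.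

Lemma bipartite_girth_ge6 : girth_ge6 e <-> square_free e.
Proof.
split=> [girth x a y b xy xa ay yb bx | sqf cyc].
  apply/eqP/negPn/negP => ab; suff: 6 <= size [:: x; a; y; b] by [].
  apply: girth; rewrite //= ?xa ?ay ?yb ?bx // !inE !negb_or ab xy.
  by rewrite (bipartite_adj_neq xa) (bipartite_adj_neq ay) (bipartite_adj_neq yb)
             eq_sym (bipartite_adj_neq bx).
case: cyc => [|x [|a [|y [|b [|z [|? ?]]]]]] //= uniq_cyc is_cycle.
- have /and4P[/e_col xa /e_col ay /e_col yx _] := is_cycle.
  by move: yx; rewrite ay xa; case: (col x).
- have /and5P[xa ay yb bx _] := is_cycle.
  move: uniq_cyc; rewrite !inE !negb_or => /and4P[/and3P[_ xy _] /andP[_ /eqP ab] _ _].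
  by case: ab; apply: sqf xy xa ay yb bx.
- have /and5P[/e_col xa /e_col ay /e_col yb /e_col bz /andP[/e_col zx _]] := is_cycle.
  by move: zx; rewrite bz yb ay xa; case: (col x).
Qed.

(* An edge inside [S] has one end of either colour, so such edges are counted once among the
   [d * k] arcs from the [k] black vertices of [S], and once among those from its white ones. *)
Lemma boundary_col_modn (d : nat) (S : {set V}) : (forall x, #|nbhd e x| = d) ->
  #|[set p in boundary e S | col p.1]| = #|[set p in boundary e S | ~~ col p.1]| %[mod d].
Proof.
move=> e_reg; pose arcs c := [set p : V * V | [&& p.1 \in S, col p.1 == c & e p.1 p.2]].
pose inner c := [set p in arcs c | p.2 \in S].
have arcs_dvd c : #|arcs c| = #|[set x in S | col x == c]| * d.
  rewrite -[RHS]sum_nat_const -sum1_card.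
  rewrite (eq_bigl (fun p => (p.1 \in [set x in S | col x == c]) && e p.1 p.2)); last first.
    by move=> p; rewrite !inE andbA.
  rewrite -(pair_big_dep _ _ (fun _ _ => 1)); apply: eq_bigr => x _.
  by rewrite sum1dep_card; apply: e_reg.
have inner_swap : #|inner true| = #|inner false|.
  have swapI : injective (fun p : V * V => (p.2, p.1)) by move=> [? ?] [? ?] [-> ->].
  rewrite -(card_imset _ swapI); apply: eq_card => -[x y].
  apply/imsetP/idP => [[[s t] st [-> ->]] |].
    move: st; rewrite !inE /= => /andP[/and3P[-> /eqP cs st] ->].
    by rewrite e_sym st (e_col st) cs.
  rewrite !inE /= => /andP[/and3P[xS /eqP cx xy] yS].
  by exists (y, x) => //; rewrite !inE /= yS xS e_sym xy (e_col xy) cx.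
have out_arcs c : #|[set p in boundary e S | col p.1 == c]| + #|inner c| = 0 %[mod d].
  rewrite mod0n -[RHS](modnMl #|[set x in S | col x == c]| d) -arcs_dvd.
  rewrite -(cardsID [set p | p.2 \in S] (arcs c)) addnC.
  congr (modn (_ + _) _); apply: eq_card => p; rewrite !inE //.
  by case: (p.1 \in S); case: (p.2 \in S); rewrite ?andbF //= andbC.
have := out_arcs true; rewrite inner_swap -(out_arcs false) => /eqP; rewrite eqn_modDr => /eqP.
congr (modn _ _ = modn _ _); apply: eq_card => p; rewrite !inE ?eqb_id //.
by rewrite eqbF_neg.
Qed.

Lemma boundary_gt1 (d : nat) (S : {set V}) (s t : V) :
  (forall x, #|nbhd e x| = d) -> 1 < d -> (forall x y, connect e x y) ->
  s \in S -> t \notin S -> 1 < #|boundary e S|.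
Proof.
move=> e_reg d_gt1 e_con sS tS; rewrite ltn_neqAle eq_sym card_gt0; apply/andP; split.
  apply/negP => /cards1P[p bdE]; have := boundary_col_modn S e_reg.
  have card_col c : #|[set q in boundary e S | c (+) col q.1]| = (c (+) col p.1).
    rewrite bdE; case: (boolP (c (+) col p.1)) => cp; last first.
      by apply: eq_card0 => q; rewrite !inE; case: eqP => // ->; apply: negbTE.
    by apply/eqP/cards1P; exists p; apply/setP => q; rewrite !inE; case: eqP => // ->.
  have := card_col false; have := card_col true => /= -> ->.
  by case: (col p.1); rewrite /= mod0n modn_small.
apply: contraNneq tS => bd0; rewrite -(closed_connect _ (e_con s t)) //.
apply: (intro_closed (sym_connect_sym e_sym)) => x y xy xS; apply/negPn/negP => yS.
by have := in_set0 (x, y); rewrite -bd0 in_boundary xS yS xy.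
Qed.

End Bipartite.

(** * (v_3) graphs *)

Local Notation "N( x )" := (nbhd (@cadj _) x) (format "N( x )").

Lemma v3P (G : cgraph) :
  v3 G <-> [/\ symmetric (@cadj G), forall x y : G, cadj x y -> ccol y = ~~ ccol x,
               cubic (@cadj G) & square_free (@cadj G)].
Proof.
split=> [[[sym _] col cubicG girth] | [sym col cubicG sqf]].
  have flip (x y : G) : cadj x y -> ccol y = ~~ ccol x.
    by move/col; case: (ccol x) (ccol y) => [] [].
  by split=> //; apply/(bipartite_girth_ge6 flip).
split=> //; last exact/(bipartite_girth_ge6 col).
  by split=> // x; apply/negP => /(bipartite_adj_neq col); rewrite eqxx.
by move=> x y /col->; case: (ccol x).
Qed.

Section V3.
Variable G : cgraph.
Hypothesis vG : v3 G.

Lemma v3_sym : symmetric (@cadj G).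
Proof. by case/v3P: vG. Qed.

Lemma v3_col (x y : G) : cadj x y -> ccol y = ~~ ccol x.
Proof. by have /v3P[_ col _ _] := vG; apply: col. Qed.

Lemma v3_neq (x y : G) : cadj x y -> x != y.
Proof. exact: (bipartite_adj_neq v3_col). Qed.

Lemma v3_square_free : square_free (@cadj G).
Proof. by case/v3P: vG. Qed.

Lemma v3_card_nbhd (x : G) : #|N(x)| = 3.
Proof. by have /v3P[_ _ cubicG _] := vG; apply: cubicG. Qed.

Lemma v3_adjE (x : G) (s : seq G) :
  size s = 3 -> uniq s -> all (cadj x) s -> cadj x =1 mem s.
Proof.
move=> size_s uniq_s /allP xs y; apply/esym; have := card_uniqP uniq_s.
have sub : {subset s <= N(x)} by move=> z /xs; rewrite inE.
rewrite size_s -(v3_card_nbhd x).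
by move/(subset_cardP)/(_ (introT subsetP sub))/(_ y); rewrite inE.
Qed.

Lemma v3_new_nbr (x : G) (s : seq G) : size s < 3 -> exists2 y, cadj x y & y \notin s.
Proof.
move=> size_s; have /subsetPn[y] : ~~ (N(x) \subset s).
  apply: contraL size_s => /subset_leq_card; rewrite v3_card_nbhd -leqNgt => /leq_trans; apply.
  exact: card_size.
by rewrite inE; exists y.
Qed.

Lemma v3_third_nbr (x y z : G) : cadj x y -> cadj x z -> y != z ->
  exists w, [/\ w != y, w != z & cadj x =1 mem [:: y; z; w]].
Proof.
move=> xy xz yz; have [w xw] := @v3_new_nbr x [:: y; z] isT.
rewrite !inE negb_or => /andP[wy wz]; exists w; split=> //.
apply: v3_adjE; rewrite //= ?xy ?xz ?xw //.
by rewrite !inE negb_or yz ![_ == w]eq_sym wy wz.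
Qed.

Lemma disjoint_nbhd_le1 (S T : {set G}) (x : G) : [disjoint S & T] ->
  (#|S :&: N(x)| <= 1) || (#|T :&: N(x)| <= 1).
Proof.
rewrite -setI_eq0 => /eqP ST0; apply: contraT.
rewrite negb_or -!ltnNge => /andP[manyS manyT].
have : #|(S :|: T) :&: N(x)| <= 3 by rewrite -(v3_card_nbhd x) subset_leq_card ?subsetIr.
rewrite setIUl cardsU setIACA ST0 set0I cards0 subn0 leqNgt => /negP; case.
exact: leq_add manyS manyT.
Qed.

Lemma v3_boundary_gt1 (S : {set G}) (s t : G) :
  gconnected G -> s \in S -> t \notin S -> 1 < #|boundary (@cadj G) S|.
Proof. by case=> _ con; apply: boundary_gt1 v3_sym v3_col _ _ _ _ v3_card_nbhd isT con. Qed.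

End V3.

(** * Matchings and reductions *)

Definition converse (T : Type) (r : rel T) : rel T := fun x y => r y x.

Definition symmetrized (T : Type) (r : rel T) : rel T := fun x y => r x y || r y x.

Definition is_matching (T : finType) (A B : {set T}) (r : rel T) : Prop :=
  [/\ forall a b, r a b -> (a \in A) && (b \in B),
      {in A, forall a, exists b, r a b}, {in B, forall b, exists a, r a b},
      (forall a b b', r a b -> r a b' -> b = b') &
      (forall a a' b, r a b -> r a' b -> a = a')].

Lemma symmetrizedC (T : Type) (r : rel T) : symmetrized (converse r) =2 symmetrized r.
Proof. by move=> x y; apply: orbC. Qed.

Lemma symmetrized_sym (T : Type) (r : rel T) : symmetric (symmetrized r).
Proof. by move=> x y; apply: orbC. Qed.

Lemma is_matchingC (T : finType) (A B : {set T}) (r : rel T) :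
  is_matching A B r -> is_matching B A (converse r).
Proof.
by case=> sub domA domB func inj; split=> // [b a /sub|b a a' | b b' a];
  [rewrite andbC | apply: inj | apply: func].
Qed.

Lemma zip_matching (T : finType) (s t : seq T) : uniq s -> uniq t -> size s = size t ->
  is_matching [set x in s] [set y in t] (fun x y => (x, y) \in zip s t).
Proof.
move=> uniq_s uniq_t size_st.
have zipP z x y : reflect (exists2 i, i < size s & x = nth z s i /\ y = nth z t i)
                          ((x, y) \in zip s t).
  apply: (iffP (nthP (z, z))); rewrite size1_zip ?size_st // => -[i lt_i].
    by rewrite nth_zip // => -[<- <-]; exists i.
  by case=> -> ->; exists i; rewrite // nth_zip.
split=> [x y /(zipP x)[i lt_i [-> ->]]|x|y|x y y'|x x' y].
- by rewrite !inE !mem_nth -?size_st.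
- rewrite inE => /(nthP x)[i lt_i <-]; exists (nth x t i).
  by apply/(zipP x); exists i.
- rewrite inE => /(nthP y)[i lt_i <-]; exists (nth y s i).
  by apply/(zipP y); exists i; rewrite ?size_st.
- move=> /(zipP x)[i lt_i [ex ->]] /(zipP x)[j lt_j [ex' ->]]; congr nth.
  by apply/eqP; rewrite -(nth_uniq x lt_i lt_j uniq_s) -ex -ex'.
- move=> /(zipP y)[i lt_i [-> ey]] /(zipP y)[j lt_j [-> ey']]; congr nth.
  by apply/eqP; rewrite size_st in lt_i lt_j; rewrite -(nth_uniq y lt_i lt_j uniq_t) -ey -ey'.
Qed.

Definition augmented (G : cgraph) (r : rel G) : rel G :=
  fun x y => cadj x y || symmetrized r x y.

Definition survives (G : cgraph) (u v : G) : pred G := fun x => (x != u) && (x != v).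

Definition reduced (G : cgraph) (u v : G) (r : rel G) : cgraph :=
  @CGraph {x : G | survives u v x} (fun x y => augmented r (val x) (val y))
          (fun x => ccol (val x)).

(* No square of the reduced graph uses one (first clause) or two (second clause) of
   the new edges; the first clause also excludes double edges. *)
Definition admissible (G : cgraph) (u v : G) (r : rel G) : Prop :=
  (forall a b x y, r a b -> x \in N(a) :\ u -> y \in N(b) :\ v -> ~~ cadj x y) /\
  (forall a b a' b', r a b -> r a' b' -> cadj a b' -> cadj a' b -> a = a').

Section Matching.
Variables (G : cgraph) (u v : G) (r : rel G).
Hypotheses (vG : v3 G) (col_uv : ccol v = ~~ ccol u).
Hypothesis r_matching : is_matching (N(u) :\ v) (N(v) :\ u) r.

Lemma matched_adj a b : r a b -> [/\ cadj u a, a != v, cadj v b & b != u].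
Proof.
by have [sub _ _ _ _] := r_matching => /sub; rewrite !inE => /andP[/andP[-> ->] /andP[-> ->]].
Qed.

Lemma matched_col a b : r a b -> ccol a = ~~ ccol u /\ ccol b = ccol u.
Proof.
by case/matched_adj => /(v3_col vG)-> _ /(v3_col vG)-> _; rewrite col_uv negbK.
Qed.

Lemma matched_survives a b : r a b -> survives u v a && survives u v b.
Proof.
case/matched_adj => ua av vb bu; rewrite /survives av bu !(eq_sym _ u) (v3_neq vG ua).
by rewrite eq_sym (v3_neq vG vb).
Qed.

Lemma symmetrized_col a b : symmetrized r a b -> ccol b = ~~ ccol a.
Proof. by case/orP => /matched_col[-> ->]; rewrite ?negbK. Qed.

Lemma augmented_col a b : augmented r a b -> ccol b = ~~ ccol a.
Proof. by case/orP => [/(v3_col vG)|/symmetrized_col]. Qed.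

Lemma augmented_sym : symmetric (augmented r).
Proof. by move=> x y; rewrite /augmented (v3_sym vG) symmetrized_sym. Qed.

Lemma symmetrized_inj a b b' : symmetrized r a b -> symmetrized r a b' -> b = b'.
Proof.
have [_ _ _ func inj] := r_matching.
have one_side c d : r a c -> r d a -> False.
  by move=> /matched_col[ca _] /matched_col[_]; rewrite ca; case: (ccol u).
case/orP => [ab|ba] /orP[ab'|b'a]; last exact: inj ba b'a.
- exact: func ab ab'.
- by case: (one_side _ _ ab b'a).
- by case: (one_side _ _ ab' ba).
Qed.

Lemma admissibleC : admissible u v r -> admissible v u (converse r).
Proof.
have [_ _ _ func _] := r_matching.
case=> detour crossing; split=> [b a y x ab yb xa | b a b' a' ab ab' ba' b'a].
  by rewrite (v3_sym vG); apply: detour ab xa yb.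
have eq_a : a = a' by apply: crossing ab ab' _ _; rewrite (v3_sym vG).
by rewrite -eq_a in ab'; apply: func ab ab'.
Qed.

Lemma augmented_matched_nbhd a b : r a b ->
  [set y | survives u v y & augmented r a y] = b |: (N(a) :\ u).
Proof.
move=> ab; have [ua _ _ _] := matched_adj ab.
have nav : cadj a v = false.
  apply: contraTF isT => /(v3_col vG); rewrite (v3_col vG ua) col_uv.
  by case: (ccol u).
apply/setP => y; rewrite !inE.
have -> : augmented r a y = cadj a y || (y == b).
  congr (_ || _); apply/idP/eqP => [ay|->]; last by rewrite /symmetrized ab.
  by apply: symmetrized_inj ay _; rewrite /symmetrized ab.
have [->|yb] := eqVneq y b; last first.
  by rewrite orbF /survives; have [->|_] := eqVneq y v; rewrite ?nav ?andbF ?andbT.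
by rewrite orbT andbT; case/andP: (matched_survives ab).
Qed.

Lemma reduced_step : ccol u -> reduction_step G (reduced u v r).
Proof.
move=> cu; have [_ domA domB func inj] := r_matching.
pose m a := odflt a [pick b | r a b].
have mE a b : r a b = [&& cadj u a, a != v & m a == b].
  apply/idP/and3P => [ab|[ua av /eqP<-]].
    have [ua av _ _] := matched_adj ab; split=> //.
    by rewrite /m; case: pickP => [b' /(func _ _ _ ab)->|/(_ b)]; rewrite ?eqxx ?ab.
  rewrite /m; case: pickP => //= none.
  have [|b' ab'] := domA a; first by rewrite !inE av.
  by rewrite none in ab'.
exists u, v, m; split; first by rewrite col_uv cu.
- move=> a ua av; have : r a (m a) by rewrite mE ua av eqxx.
  by case/matched_adj.
- move=> a b ua av ub bv mab; apply: (inj a b (m a)); rewrite mE ?ua ?av ?eqxx //.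
  by rewrite ub bv mab eqxx.
- move=> b vb bu; have [|a ab] := domB b; first by rewrite !inE vb bu.
  by exists a; move: ab; rewrite mE => /and3P[? ? /eqP].
exists val; split=> //; first exact: val_inj.
- by move=> x; have /andP[] := valP x.
- move=> y yu yv; have sy : survives u v y by rewrite /survives yu.
  by exists (Sub y sy).
- by move=> x y; rewrite /= /augmented /symmetrized !mE.
Qed.

End Matching.

Section Admissible.
Variables (G : cgraph) (u v : G) (r : rel G).
Hypotheses (vG : v3 G) (col_uv : ccol v = ~~ ccol u).
Hypothesis r_matching : is_matching (N(u) :\ v) (N(v) :\ u) r.
Hypothesis r_adm : admissible u v r.

Lemma matched_nadj a b : r a b -> ~~ cadj a b.
Proof.
have [detour _] := r_adm => ab; have [_ av _ bu] := matched_adj r_matching ab.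
apply/negP => adj_ab; suff: ~~ cadj b a by rewrite (v3_sym vG) adj_ab.
by apply: detour ab _ _; rewrite !inE ?bu ?av // (v3_sym vG).
Qed.

Lemma symmetrized_no_detour a b x y : symmetrized r a b ->
  cadj a x -> survives u v x -> cadj b y -> survives u v y -> ~~ cadj x y.
Proof.
move=> ab ax /andP[xu xv] bY /andP[yu yv]; have [detour _] := r_adm.
case/orP: ab => ab; last rewrite (v3_sym vG).
  by apply: detour ab _ _; rewrite !inE ?xu ?yv.
by apply: detour ab _ _; rewrite !inE ?xv ?yu.
Qed.

Lemma symmetrized_no_crossing x a y b : symmetrized r x a -> symmetrized r y b ->
  ccol x = ccol y -> cadj a y -> cadj b x -> x = y.
Proof.
have [_ _ _ func _] := r_matching.
move=> xa yb cxy ay bx; have [_ crossing] := r_adm.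
have col := matched_col vG col_uv r_matching.
case/orP: xa => [xa|ax]; case/orP: yb => [yb|b_y].
- by apply: crossing xa yb _ _; rewrite (v3_sym vG).
- by move: cxy; have [-> _] := col _ _ xa; have [_ ->] := col _ _ b_y; case: (ccol u).
- by move: cxy; have [_ ->] := col _ _ ax; have [-> _] := col _ _ yb; case: (ccol u).
- by have ab := crossing _ _ _ _ ax b_y ay bx; rewrite -ab in b_y; apply: func ax b_y.
Qed.

Lemma augmented_square_free x a y b :
  survives u v x -> survives u v a -> survives u v y -> survives u v b -> x != y ->
  augmented r x a -> augmented r a y -> augmented r y b -> augmented r b x -> a = b.
Proof.
move=> sx sa sy sb xy; have unique s t t' : symmetrized r t s -> symmetrized r s t' -> t = t'.
  by rewrite symmetrized_sym; apply: symmetrized_inj vG col_uv r_matching _ _ _.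
have detour s t s' t' st ss' ls tt' lt : ~ cadj s' t' :=
  negP (@symmetrized_no_detour s t s' t' st ss' ls tt' lt).
have new_col := symmetrized_col vG col_uv r_matching.
have xy_ab : x = y -> a = b by move/eqP; rewrite (negbTE xy).
have sym := v3_sym vG.
case/orP=> xa; case/orP=> ay; case/orP=> yb; case/orP=> bx;
  try by [exact: unique ay yb | apply/esym/(unique _ _ _ bx xa)
         | exact/xy_ab/(unique _ _ _ xa ay) | exact/xy_ab/esym/(unique _ _ _ yb bx)].
- exact: v3_square_free vG _ _ _ _ xy xa ay yb bx.
- by case: (detour b x y a bx _ sy _ sa); rewrite // sym.
- by case: (detour y b a x yb _ sa _ sx); rewrite // sym.
- by case: (detour a y x b ay _ sx _ sb); rewrite // sym.
- by apply: (symmetrized_no_crossing ay bx _ yb xa); rewrite (v3_col vG xa) (new_col _ _ bx) negbK.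
- by case: (detour x a b y xa _ sb _ sy); rewrite // sym.
- apply/xy_ab/(symmetrized_no_crossing xa yb _ ay bx).
  by rewrite (v3_col vG ay) (new_col _ _ xa) negbK.
Qed.

Lemma card_augmented_nbhd x : survives u v x ->
  #|[set y | survives u v y & augmented r x y]| = 3.
Proof.
move=> sx; have [_ domA domB _ _] := r_matching; have /andP[xNu xNv] := sx.
have card_swap w b : cadj x w -> ~~ cadj x b -> #|b |: (N(x) :\ w)| = 3.
  move=> xw xb; rewrite cardsU1 !inE (negbTE xb) andbF.
  by have := cardsD1 w N(x); rewrite (v3_card_nbhd vG) inE xw.
have [xu | nxu] := boolP (cadj x u).
  have [|b xb] := domA x; first by rewrite !inE (v3_sym vG) xu xNv.
  rewrite (augmented_matched_nbhd vG col_uv r_matching xb).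
  exact: card_swap xu (matched_nadj xb).
have [xv | nxv] := boolP (cadj x v).
  have [|a ax] := domB x; first by rewrite !inE (v3_sym vG) xv xNu.
  have nxa : ~~ cadj x a by rewrite (v3_sym vG) matched_nadj.
  rewrite -(card_swap v a xv nxa).
  rewrite -(augmented_matched_nbhd vG _ (is_matchingC r_matching) (ax : converse r x a)).
    by apply: eq_card => y; rewrite !inE /augmented symmetrizedC /survives [_ && (y != u)]andbC.
  by rewrite col_uv negbK.
rewrite -(v3_card_nbhd vG x); apply: eq_card => y; rewrite !inE.
have -> : augmented r x y = cadj x y.
  apply/orb_idr => /orP[/(matched_adj r_matching)[] | /(matched_adj r_matching)[_ _]].
    by rewrite (v3_sym vG) (negbTE nxu).
  by rewrite (v3_sym vG) (negbTE nxv).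
rewrite andbC; apply/andb_idr => xy.
by apply/andP; split; apply: contraTneq xy => ->.
Qed.

Lemma reduced_v3 : v3 (reduced u v r).
Proof.
apply/v3P; split=> [x y | x y | x | x a y b xy xa ay yb bx].
- exact: augmented_sym vG _ _.
- exact: (augmented_col vG col_uv r_matching).
- rewrite -(card_augmented_nbhd (valP x)) -(card_imset _ val_inj); apply: eq_card => y.
  apply/imsetP/idP => [[y' + ->]|]; rewrite !inE; first by rewrite (valP y').
  by case/andP => sy xy; exists (Sub y sy); rewrite ?inE.
- exact/val_inj/(augmented_square_free (valP x) (valP a) (valP y) (valP b)).
Qed.

End Admissible.

Section Connectivity.
Variables (G : cgraph) (u v : G) (r : rel G).
Hypotheses (vG : v3 G) (con_G : gconnected G).
Hypothesis r_matching : is_matching (N(u) :\ v) (N(v) :\ u) r.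

Section ClosedSet.
Variable S : {set G}.
Hypothesis S_survives : {subset S <= survives u v}.
Hypothesis S_closed : forall x y, x \in S -> survives u v y -> augmented r x y -> y \in S.

Lemma closed_notin : u \notin S /\ v \notin S.
Proof. by split; apply/negP => /S_survives; rewrite unfold_in /survives eqxx ?andbF. Qed.

Lemma closed_matched a b : r a b -> (a \in S) = (b \in S).
Proof.
move=> ab; have /andP[sa sb] := matched_survives vG r_matching ab.
by apply/idP/idP => /S_closed; apply; rewrite // /augmented /symmetrized ab !orbT.
Qed.

Lemma closed_exit x y : (x, y) \in boundary (@cadj G) S ->
  (exists2 b, r x b & y = u) \/ (exists2 a, r a x & y = v).
Proof.
have [_ domA domB _ _] := r_matching; have [uS vS] := closed_notin.
rewrite in_boundary => /and3P[xS yS xy].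
have [yu | yNu] := eqVneq y u.
  left; have [|b xb] := domA x; last by exists b.
  by rewrite !inE (v3_sym vG) -yu xy andbT; apply: contraNneq vS => <-.
have [yv | yNv] := eqVneq y v.
  right; have [|a ax] := domB x; last by exists a.
  by rewrite !inE (v3_sym vG) -yv xy andbT; apply: contraNneq uS => <-.
by case/negP: yS; apply: S_closed xS _ _; rewrite /survives ?yNu // /augmented xy.
Qed.

Lemma closed_boundary : S != set0 -> #|S :&: N(u)| <= 1 ->
  exists a b, r a b /\ boundary (@cadj G) S = [set (a, u); (b, v)].
Proof.
move=> /set0Pn[s sS] /card_le1_eqP one; have [_ _ _ func _] := r_matching.
have [uS vS] := closed_notin.
have [a [b [ab aS]]] : exists a b, r a b /\ a \in S.
  have /ltnW/card_gt0P[[x y] xy_out] := v3_boundary_gt1 vG con_G sS uS.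
  have xS : x \in S by move: xy_out; rewrite in_boundary => /andP[].
  case: (closed_exit xy_out) => -[z zx _]; first by exists x, z.
  by exists z, x; rewrite (closed_matched zx).
have bS : b \in S by rewrite -(closed_matched ab).
have only a' b' : a' \in S -> r a' b' -> a' = a.
  have in_nbhd x y : x \in S -> r x y -> x \in S :&: N(u).
    by move=> xS /(matched_adj r_matching)[ux _ _ _]; rewrite !inE xS.
  by move=> a'S a'b'; apply: one (in_nbhd _ _ aS ab) (in_nbhd _ _ a'S a'b').
exists a, b; split=> //; apply/setP => -[x y]; rewrite in_set2.
apply/idP/orP => [xy_out | ].
  have xS : x \in S by move: xy_out; rewrite in_boundary => /andP[].
  case: (closed_exit xy_out) => -[z zx ->]; [left | right]; first by rewrite (only x z).
  rewrite -(closed_matched zx) in xS; have za := only z x xS zx.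
  by rewrite za in zx; rewrite (func _ _ _ ab zx).
have [ua _ vb _] := matched_adj r_matching ab.
by case=> /eqP[-> ->]; rewrite in_boundary (v3_sym vG) ?aS ?uS ?bS ?vS.
Qed.

End ClosedSet.

Lemma reduced_connected_or_cut :
  gconnected (reduced u v r) \/
  exists S a b, r a b /\ boundary (@cadj G) S = [set (a, u); (b, v)].
Proof.
have sym : connect_sym (@cadj (reduced u v r)).
  by apply: sym_connect_sym => x y; apply: augmented_sym.
have [/'forall_forallP con | ] :=
  boolP [forall x, [forall y, connect (@cadj (reduced u v r)) x y]].
  left; split=> //; have [|a ua] := @v3_new_nbr _ vG u [:: v]; first by [].
  rewrite inE => av; have sa : survives u v a by rewrite /survives av eq_sym (v3_neq vG ua).
  by apply/card_gt0P; exists (Sub a sa).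
rewrite negb_forall => /existsP[x]; rewrite negb_forall => /existsP[y xy]; right.
pose S c := val @: [set z | connect (@cadj (reduced u v r)) x z == c].
have mem_S c z : (val z \in S c) = (connect (@cadj (reduced u v r)) x z == c).
  by rewrite mem_imset ?inE //; apply: val_inj.
have [c few] : exists c, #|S c :&: N(u)| <= 1.
  have disj : [disjoint S true & S false].
    rewrite disjoints_subset; apply/subsetP => _ /imsetP[z + ->].
    by rewrite inE => /eqP xz; rewrite inE mem_S xz.
  by case/orP: (disjoint_nbhd_le1 vG u disj) => few; [exists true | exists false].
exists (S c); apply: closed_boundary few.
- by move=> _ /imsetP[z _ ->]; apply: (valP z).
- move=> _ t /imsetP[z + ->] st; rewrite inE => xz zt.
  pose t' : reduced u v r := Sub t st; rewrite -[t]/(val t') mem_S -(eqP xz).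
  have zt' : cadj (z : reduced u v r) t' by [].
  by rewrite (same_connect_r sym (connect1 zt')).
- apply/set0Pn; case: c; [exists (val x) | exists (val y)];
    by rewrite mem_S ?connect0 // (negbTE xy).
Qed.

End Connectivity.

(** * Edge cuts of irreducible graphs *)

Section TwoEdgeBoundary.
Variables (V : finType) (e : rel V) (S : {set V}) (a u b v : V).
Hypothesis cut : boundary e S = [set (a, u); (b, v)].

Lemma cut_ends : [/\ a \in S, u \notin S, e a u & [/\ b \in S, v \notin S & e b v]].
Proof.
have: (a, u) \in boundary e S by rewrite cut !inE eqxx.
have: (b, v) \in boundary e S by rewrite cut !inE eqxx orbT.
by rewrite !in_boundary => /and3P[-> -> ->] /and3P[-> -> ->].
Qed.

Lemma cut_exit x y : x \in S -> e x y ->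
  (y \notin S) = [|| (x == a) && (y == u) | (x == b) && (y == v)].
Proof. by move=> xS xy; move/setP/(_ (x, y)): cut; rewrite in_boundary !inE xS xy andbT. Qed.

Lemma cut_inner x y : x \in S -> x != a -> x != b -> e x y -> y \in S.
Proof.
by move=> xS /negbTE xa /negbTE xb xy; apply/negPn; rewrite (cut_exit xS xy) xa xb.
Qed.

Lemma cut_outer x y : symmetric e -> x \notin S -> x != u -> x != v -> e x y -> y \notin S.
Proof.
move=> e_sym xS /negbTE xu /negbTE xv; rewrite e_sym => yx; apply: contraNN xS => yS.
by apply/negPn; rewrite (cut_exit yS yx) xu xv !andbF.
Qed.

End TwoEdgeBoundary.

Definition irreducible (G : cgraph) : Prop :=
  forall G', reduction_step G G' -> v3 G' -> gconnected G' -> False.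

Section Irreducible.
Variable G : cgraph.
Hypotheses (vG : v3 G) (con_G : gconnected G) (irr_G : irreducible G).

Lemma v3_bridgeless (S : {set G}) (s t : G) p : s \in S -> t \notin S ->
  boundary (@cadj G) S \subset [set p] -> False.
Proof.
move=> sS tS /subset_leq_card; rewrite cards1 leqNgt => /negP; apply.
exact: v3_boundary_gt1 sS tS.
Qed.

Lemma irreducible_cut (u v : G) (r : rel G) : ccol v = ~~ ccol u ->
  is_matching (N(u) :\ v) (N(v) :\ u) r -> admissible u v r ->
  exists S a b, r a b /\ boundary (@cadj G) S = [set (a, u); (b, v)].
Proof.
have black_cut u' v' r' : ccol u' -> ccol v' = ~~ ccol u' ->
    is_matching (N(u') :\ v') (N(v') :\ u') r' -> admissible u' v' r' ->
    exists S a b, r' a b /\ boundary (@cadj G) S = [set (a, u'); (b, v')].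
  move=> black_u col_uv matching adm.
  have [con | //] := reduced_connected_or_cut vG con_G matching.
  case: (irr_G (reduced_step col_uv matching black_u) _ con).
  exact: reduced_v3 vG col_uv matching adm.
move=> col_uv matching adm; have [black_u | white_u] := boolP (ccol u); first exact: black_cut.
have [||S [b [a [ab cut]]]] :=
  black_cut v u _ _ _ (is_matchingC matching) (admissibleC vG matching adm).
- by rewrite col_uv.
- by rewrite col_uv negbK.
by exists S, a, b; rewrite setUC.
Qed.

Section TwoEdgeCut.
Variables (S : {set G}) (a u b v : G).
Hypothesis col_uv : ccol v = ~~ ccol u.
Hypothesis cut : boundary (@cadj G) S = [set (a, u); (b, v)].

Lemma cut_ends_col : ccol b = ~~ ccol a.
Proof.
have [_ _ au [_ _ bv]] := cut_ends cut.
by move: col_uv; rewrite (v3_col vG au) (v3_col vG bv) => /negb_inj.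
Qed.

Lemma cut_ends_neq : a != b /\ u != v.
Proof.
split; first by apply: contra_eqN cut_ends_col => /eqP->; case: (ccol b).
by apply: contra_eqN col_uv => /eqP->; case: (ccol v).
Qed.

Lemma cut_ends_nbrs :
  [/\ forall y, cadj a y -> y != u -> y \in S, forall y, cadj b y -> y != v -> y \in S,
      forall x, cadj u x -> x != a -> x \notin S & forall x, cadj v x -> x != b -> x \notin S].
Proof.
have [aS uS _ [bS vS _]] := cut_ends cut; have [aNb uNv] := cut_ends_neq.
split=> [y ay /negbTE yu | y b_y /negbTE yv | x ux /negbTE xa | x vx /negbTE xb].
- by apply/negPn; rewrite (cut_exit cut aS ay) yu (negbTE aNb) andbF.
- by apply/negPn; rewrite (cut_exit cut bS b_y) yv eq_sym (negbTE aNb) andbF.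
- apply/negP => xS; have := cut_exit cut xS (etrans (v3_sym vG x u) ux).
  by rewrite uS xa (negbTE uNv) andbF.
- apply/negP => xS; have := cut_exit cut xS (etrans (v3_sym vG x v) vx).
  by rewrite vS xb [v == u]eq_sym (negbTE uNv) andbF.
Qed.

(* Every edge from [T :\: S] to [S] ends in [a] or [b], hence leaves [T], so that
   [T :\: S] has only one edge leaving it. *)
Lemma no_transversal_cut (T : {set G}) x y : boundary (@cadj G) T = [set (x, b); (y, a)] ->
  (x \in S) != (y \in S) -> False.
Proof.
move=> cutT xyS; have [aS _ _ _] := cut_ends cut.
have [xT bT _ [yT aT _]] := cut_ends cutT.
have exit s t : s \in T :\: S -> t \notin T :\: S -> cadj s t ->
    (s == x) && (t == b) || (s == y) && (t == a).
  rewrite !inE => /andP[sS sT] tTS st; rewrite -(cut_exit cutT sT st).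
  apply: contra tTS => tT; rewrite tT andbT; apply/negP => tS.
  have := cut_exit cut tS (etrans (v3_sym vG t s) st).
  rewrite sS => /esym/orP[] /andP[/eqP ends _]; first by rewrite -ends tT in aT.
  by rewrite -ends tT in bT.
have notin_S s : s \in T :\: S -> s \notin S by case/setDP.
case xS: (x \in S) xyS => /= yS.
  apply: (@v3_bridgeless (T :\: S) y a (y, a)); rewrite ?inE ?yS ?aS //.
  apply/subsetP => -[s t]; rewrite in_boundary => /and3P[sTS tTS st].
  case/orP: (exit s t sTS tTS st) => /andP[/eqP eq_s /eqP->].
    by have := notin_S s sTS; rewrite eq_s xS.
  by rewrite eq_s set11.
apply: (@v3_bridgeless (T :\: S) x a (x, b)); rewrite ?inE ?xS ?aS //.
apply/subsetP => -[s t]; rewrite in_boundary => /and3P[sTS tTS st].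
case/orP: (exit s t sTS tTS st) => /andP[/eqP eq_s /eqP->]; first by rewrite eq_s set11.
by have := notin_S s sTS; rewrite eq_s -(negbK (y \in S)) yS.
Qed.

Section AdjacentEnds.
Variables p q : G.
Hypotheses (ab : cadj a b) (pb : p != b) (pu : p != u) (qa : q != a) (qv : q != v).
Hypotheses (nbr_a : cadj a =1 mem [:: b; u; p]) (nbr_b : cadj b =1 mem [:: a; v; q]).

(* Both new edges [v p] and [q u] join the two sides of the cut. *)
Let r : rel G := fun x y => (x, y) \in zip [:: v; q] [:: p; u].

Lemma adjacent_ends_matching : is_matching (N(b) :\ a) (N(a) :\ b) r.
Proof.
have [aS uS _ [bS vS _]] := cut_ends cut.
have -> : N(b) :\ a = [set x in [:: v; q]].
  apply/setP => x; rewrite !inE nbr_b !inE; have [->|] //= := eqVneq x a.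
  by rewrite [a == q]eq_sym (negbTE qa) orbF; apply/esym/negbTE; apply: contraNneq vS => <-.
have -> : N(a) :\ b = [set x in [:: p; u]].
  apply/setP => x; rewrite !inE nbr_a !inE.
  have [->|_] := eqVneq x b; last by rewrite /= orbC.
  by rewrite [b == p]eq_sym (negbTE pb); apply/esym/negbTE; apply: contraNneq uS => <-.
by apply: zip_matching; rewrite //= inE ?andbT // eq_sym.
Qed.

Lemma adjacent_ends_inner : [/\ p \in S, q \in S, p != a & q != b].
Proof.
have [inner_a inner_b _ _] := cut_ends_nbrs.
have ap : cadj a p by rewrite nbr_a !inE eqxx !orbT.
have bq : cadj b q by rewrite nbr_b !inE eqxx !orbT.
by rewrite inner_a // inner_b // ![_ == a]eq_sym ![_ == b]eq_sym (v3_neq vG ap) (v3_neq vG bq).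
Qed.

Lemma adjacent_ends_no_square : ~ cadj v u.
Proof.
have [_ uS au [bS vS bv]] := cut_ends cut => vu.
have eq_bu : b = u.
  apply: (v3_square_free vG (x := a) (y := v)) => //; last by rewrite (v3_sym vG).
  by apply: contraNneq vS => <-; have [] := cut_ends cut.
by rewrite -eq_bu bS in uS.
Qed.

Lemma adjacent_ends_admissible : admissible b a r.
Proof.
have [_ _ outer_u outer_v] := cut_ends_nbrs; have [pS qS pa qb] := adjacent_ends_inner.
have rP x y : r x y -> (x = v /\ y = p) \/ (x = q /\ y = u).
  by rewrite /r /= !inE => /orP[] /eqP[-> ->]; [left | right].
split=> [x y s t /rP[] [-> ->] | x y x' y' /rP[] [-> ->] /rP[] [-> ->] //]; rewrite ?inE.
- move=> /andP[sb vs] /andP[ta pt]; apply/negP; rewrite (v3_sym vG) => ts.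
  have := cut_exit cut (cut_inner cut pS pa pb pt) ts.
  by rewrite outer_v // (negbTE ta) [s == v]eq_sym (negbTE (v3_neq vG vs)) andbF.
- move=> /andP[sb qs] /andP[ta ut]; apply/negP => st.
  have := cut_exit cut (cut_inner cut qS qa qb qs) st.
  by rewrite outer_u // (negbTE sb) [t == u]eq_sym (negbTE (v3_neq vG ut)) andbF.
- by move=> vu _; case: adjacent_ends_no_square.
- by move=> _ vu; case: adjacent_ends_no_square.
Qed.

Lemma no_adjacent_ends : False.
Proof.
have [_ uS _ [_ vS _]] := cut_ends cut; have [pS qS _ _] := adjacent_ends_inner.
have [T [x [y [xy cutT]]]] := irreducible_cut (v3_col vG (etrans (v3_sym vG b a) ab))
  adjacent_ends_matching adjacent_ends_admissible.
apply: (no_transversal_cut cutT); move: xy; rewrite /r /= !inE.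
by case/orP=> /eqP[-> ->]; rewrite ?pS ?qS ?(negbTE vS) ?(negbTE uS).
Qed.

End AdjacentEnds.

Lemma cut_ends_nadj : ~~ cadj a b.
Proof.
have [aS uS au [bS vS bv]] := cut_ends cut.
have bNu : b != u by apply: contraNneq uS => <-.
have aNv : a != v by apply: contraNneq vS => <-.
apply/negP => ab; have ba : cadj b a by rewrite (v3_sym vG).
have [p [pb pu nbr_a]] := v3_third_nbr vG ab au bNu.
have [q [qa qv nbr_b]] := v3_third_nbr vG ba bv aNv.
exact: no_adjacent_ends ab pb pu qa qv nbr_a nbr_b.
Qed.

End TwoEdgeCut.

Section CutEdgeReduction.
Variables (S : {set G}) (a u b v : G).
Hypothesis col_uv : ccol v = ~~ ccol u.
Hypothesis cut : boundary (@cadj G) S = [set (a, u); (b, v)].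

Lemma cut_outer_ends_nadj : ~~ cadj u v.
Proof.
apply: (@cut_ends_nadj (~: S) u a v b (cut_ends_col col_uv cut)); apply/setP => -[x y].
have := congr1 (fun B : {set G * G} => (y, x) \in B) cut.
rewrite !in_boundary !inE negbK (v3_sym vG) andbCA => ->.
by rewrite !xpair_eqE ![(y == _) && _]andbC.
Qed.

(* As [a], [b] and also [u], [v] are not adjacent, any matching will do. *)
Let r : rel G := fun x y => (x, y) \in zip (enum (N(u) :\ a)) (enum (N(a) :\ u)).

Lemma cut_edge_matching : is_matching (N(u) :\ a) (N(a) :\ u) r.
Proof.
have [_ _ au _] := cut_ends cut.
have card_nbhdD1 (x y : G) : cadj x y -> #|N(x) :\ y| = 2.
  by move=> xy; have := cardsD1 y N(x); rewrite (v3_card_nbhd vG) inE xy => -[].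
have := @zip_matching G (enum (N(u) :\ a)) (enum (N(a) :\ u)) (enum_uniq _) (enum_uniq _).
by rewrite !set_enum; apply; rewrite -!cardE !card_nbhdD1 // (v3_sym vG).
Qed.

Lemma cut_edge_matched x y : r x y ->
  [/\ x \notin S, x != u, x != v & [/\ y \in S, y != a & y != b]].
Proof.
move=> xy; have [ux xa ay yu] := matched_adj cut_edge_matching xy.
have [inner_a _ outer_u _] := cut_ends_nbrs col_uv cut.
split; rewrite ?outer_u //; first by rewrite eq_sym (v3_neq vG ux).
  by apply: contraNneq cut_outer_ends_nadj => <-.
split; rewrite ?inner_a //; first by rewrite eq_sym (v3_neq vG ay).
by apply: contraNneq (cut_ends_nadj col_uv cut) => <-.
Qed.

Lemma cut_edge_admissible : admissible u a r.
Proof.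
split=> [x y s t xy | x y x' y' xy x'y'].
  have [xS xu xv [yS ya yb]] := cut_edge_matched xy.
  rewrite !inE => /andP[su xs] /andP[ta yt]; apply/negP; rewrite (v3_sym vG) => ts.
  have := cut_exit cut (cut_inner cut yS ya yb yt) ts.
  rewrite (cut_outer cut (v3_sym vG) xS xu xv xs) (negbTE su) andbF => /esym/andP[/eqP eq_tb _].
  have [_ _ ay _] := matched_adj cut_edge_matching xy.
  have := v3_col vG yt; rewrite eq_tb (cut_ends_col col_uv cut) (v3_col vG ay).
  by case: (ccol a).
have [xS _ _ _] := cut_edge_matched xy; have [_ _ _ [y'S y'a y'b]] := cut_edge_matched x'y'.
by rewrite (v3_sym vG) => /(cut_inner cut y'S y'a y'b); rewrite (negbTE xS).
Qed.

Section CrossingCut.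
Variables (T : {set G}) (x y : G).
Hypotheses (xS : x \notin S) (yS : y \in S).
Hypothesis cutT : boundary (@cadj G) T = [set (x, u); (y, a)].

Lemma crossing_cut_mem : b \in T.
Proof.
have [_ _ _ [yT aT _]] := cut_ends cutT; apply/negPn/negP => bT.
apply: (@v3_bridgeless (T :&: S) y a (y, a)); rewrite ?inE ?yT ?yS ?(negbTE aT) //.
apply/subsetP => -[s t]; rewrite in_boundary !inE => /and3P[/andP[sT sS] + st].
have [tT /= tS | tT _] := boolP (t \in T).
  have := cut_exit cut sS st; rewrite tS => /esym/orP[] /andP[/eqP eq_s _].
    by rewrite -eq_s sT in aT.
  by rewrite -eq_s sT in bT.
have := cut_exit cutT sT st; rewrite tT => /esym/orP[] // /andP[/eqP eq_s _].
by have := xS; rewrite -eq_s sS.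
Qed.

Lemma crossing_cut_notin : b \notin T.
Proof.
have [aS uS au _] := cut_ends cut; have [_ _ _ [yT aT y_a]] := cut_ends cutT.
apply/negP => bT; have ay : cadj a y by rewrite (v3_sym vG).
have uNy : u != y by apply: contraNneq uS => ->.
have [w [wu wy nbr_a]] := v3_third_nbr vG au ay uNy.
have aw : cadj a w by rewrite nbr_a !inE eqxx !orbT.
have wS : w \in S by have [inner_a _ _ _] := cut_ends_nbrs col_uv cut; apply: inner_a.
have wT : w \notin T.
  apply/negP => wT; have := cut_exit cutT wT (etrans (v3_sym vG w a) aw).
  rewrite aT (negbTE wy) orbF => /esym/andP[_ /eqP eq_au].
  by rewrite -eq_au aS in uS.
have wa : w != a by rewrite eq_sym (v3_neq vG aw).
apply: (@v3_bridgeless (S :\: T :\ a) w a (w, a)); rewrite ?inE ?wT ?wa ?wS ?eqxx //.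
apply/subsetP => -[s t]; rewrite in_boundary !inE => /and3P[/and3P[sa sT sS] + st].
have tS : t \in S.
  apply/negPn; rewrite (cut_exit cut sS st) (negbTE sa); apply/negP => /andP[/eqP eq_sb _].
  by rewrite eq_sb bT in sT.
have tT : t \notin T.
  apply/negP => tT; have := cut_exit cutT tT (etrans (v3_sym vG t s) st).
  rewrite sT (negbTE sa) andbF orbF => /esym/andP[/eqP eq_tx _].
  by have := xS; rewrite -eq_tx tS.
rewrite tS tT !andbT negbK => /eqP eq_ta; rewrite eq_ta xpair_eqE eqxx andbT.
move: st; rewrite eq_ta (v3_sym vG) nbr_a !inE => /or3P[] /eqP // eq_s.
  by rewrite -eq_s sS in uS.
by rewrite eq_s yT in sT.
Qed.

End CrossingCut.

Lemma no_edge_cut2 : False.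
Proof.
have [_ _ au _] := cut_ends cut.
have col_au : ccol a = ~~ ccol u by apply: (v3_col vG); rewrite (v3_sym vG).
have [T [x [y [xy cutT]]]] := irreducible_cut col_au cut_edge_matching cut_edge_admissible.
have [xS _ _ [yS _ _]] := cut_edge_matched xy.
by have := crossing_cut_notin xS yS cutT; rewrite (crossing_cut_mem xS yS cutT).
Qed.

End CutEdgeReduction.

Lemma irreducible_not_admissible (u v : G) (r : rel G) : ccol v = ~~ ccol u ->
  is_matching (N(u) :\ v) (N(v) :\ u) r -> ~ admissible u v r.
Proof.
move=> col_uv matching /(irreducible_cut col_uv matching)[S [a [b [_ cut]]]].
exact: no_edge_cut2 col_uv cut.
Qed.

End Irreducible.

(** * Patterns *)

(* Vertex [i] of a pattern has a colour and a list of its known neighbours; it may have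
   further neighbours while there are fewer than three. *)
Definition pattern := seq (bool * seq nat).

Definition order (P : pattern) : nat := size P.
Definition colour (P : pattern) (x : nat) : bool := (nth (false, [::]) P x).1.
Definition nbrs (P : pattern) (x : nat) : seq nat := (nth (false, [::]) P x).2.
Definition full (P : pattern) (x : nat) : bool := (size (nbrs P x) == 3) && uniq (nbrs P x).

Definition add_nbr (P : pattern) (x y : nat) : pattern :=
  set_nth (false, [::]) P x (colour P x, y :: nbrs P x).

Definition link (P : pattern) (x y : nat) : pattern := add_nbr (add_nbr P x y) y x.

Definition add_vertex (P : pattern) (c : bool) : pattern := rcons P (c, [::]).

(* An edge [(x, order P)] leads from [x] to a new vertex. *)
Definition add_edge (P : pattern) (d : nat * nat) : pattern :=
  link (if d.2 < order P then P else add_vertex P (~~ colour P d.1)) d.1 d.2.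

(* Only the edges are preserved: [f] may send non-adjacent vertices to adjacent ones, and
   it may exchange the two colours. *)
Definition embedding (G : cgraph) (P : pattern) (f : nat -> G) : Prop :=
  [/\ {in gtn (order P) &, injective f},
      (forall i j, j \in nbrs P i -> j < order P /\ cadj (f i) (f j)) &
      exists c, forall i, i < order P -> ccol (f i) = c (+) colour P i].

Definition excluded (G : cgraph) (P : pattern) : Prop := forall f : nat -> G, ~ embedding P f.

Lemma nbrs_link P x y i : x != y -> nbrs (link P x y) i =i
  [pred j | [|| j \in nbrs P i, (i == x) && (j == y) | (i == y) && (j == x)]].
Proof.
move=> xy j; have nbrs_add Q s t k :
    nbrs (add_nbr Q s t) k = if k == s then t :: nbrs Q s else nbrs Q k.
  by rewrite /nbrs nth_set_nth /=; case: eqP.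
rewrite !nbrs_add inE; have [->|iy] := eqVneq i y; first by rewrite eq_sym (negbTE xy) inE orbC.
by have [->|ix] := eqVneq i x; rewrite ?inE ?orbF // orbC.
Qed.

Lemma colour_link P x y i : colour (link P x y) i = colour P i.
Proof.
have colour_add Q s t : colour (add_nbr Q s t) i = colour Q i.
  by rewrite /colour nth_set_nth /=; case: eqP => // ->.
by rewrite !colour_add.
Qed.

Lemma order_link P x y : x < order P -> y < order P -> order (link P x y) = order P.
Proof. by move=> lt_x lt_y; rewrite /order !size_set_nth (maxn_idPr lt_x) (maxn_idPr lt_y). Qed.

Lemma full_lt P i : full P i -> i < order P.
Proof. by apply: contraTltn => ge_i; rewrite /full /nbrs nth_default. Qed.

Section Embedding.
Variables (G : cgraph) (P : pattern) (f : nat -> G).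
Hypotheses (vG : v3 G) (f_emb : embedding P f).

Lemma embedding_eq i j : i < order P -> j < order P -> (f i == f j) = (i == j).
Proof. by case: f_emb => inj _ _ lt_i lt_j; apply/eqP/eqP => [/inj-> //|->]. Qed.

Lemma embedding_adj i j : j \in nbrs P i -> cadj (f i) (f j).
Proof. by case: f_emb => _ adj _ /adj[]. Qed.

Lemma nbrs_lt i : all (gtn (order P)) (nbrs P i).
Proof. by case: f_emb => _ adj _; apply/allP => j /adj[]. Qed.

Lemma embedding_mem j s : j < order P -> all (gtn (order P)) s -> (f j \in map f s) = (j \in s).
Proof.
move=> lt_j /allP lt_s; apply/mapP/idP => [[i si /eqP]|sj]; last by exists j.
by rewrite embedding_eq // => [/eqP-> //|]; apply: lt_s.
Qed.

Lemma embedding_uniq s : all (gtn (order P)) s -> uniq (map f s) = uniq s.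
Proof.
move=> /allP lt_s; rewrite map_inj_in_uniq // => i j /lt_s lt_i /lt_s lt_j.
by case: f_emb => inj _ _; apply: inj.
Qed.

Lemma full_adj i y : full P i -> cadj (f i) y = (y \in map f (nbrs P i)).
Proof.
case/andP=> /eqP size_i uniq_i.
apply: (v3_adjE vG); rewrite ?size_map ?embedding_uniq ?nbrs_lt //.
by apply/allP => _ /mapP[j ij ->]; apply: embedding_adj.
Qed.

Lemma full_embedding_adj i j : full P i -> j < order P -> cadj (f i) (f j) = (j \in nbrs P i).
Proof. by move=> full_i lt_j; rewrite full_adj // embedding_mem // nbrs_lt. Qed.

Lemma full_nbhdD1 i j : full P i -> j < order P ->
  [set y in map f (rem j (nbrs P i))] = N(f i) :\ f j.
Proof.
move=> full_i lt_j; have /andP[_ uniq_i] := full_i; apply/setP => y; rewrite !inE full_adj //.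
apply/mapP/andP => [[k + ->] | [yj /mapP[k ik eq_y]]].
  rewrite mem_rem_uniq // inE => /andP[kj ik]; have lt_k : k < order P := allP (nbrs_lt i) k ik.
  by rewrite map_f // embedding_eq.
by exists k; rewrite // mem_rem_uniq // inE ik andbT; apply: contraNneq yj => <-; rewrite eq_y.
Qed.

Lemma embedding_link x y : x < order P -> y < order P -> cadj (f x) (f y) ->
  embedding (link P x y) f.
Proof.
move=> lt_x lt_y xy; have xNy : x != y by have := v3_neq vG xy; rewrite embedding_eq.
have [inj adj [c col_f]] := f_emb; split; rewrite ?order_link //; last first.
  by exists c => i lt_i; rewrite colour_link; apply: col_f.
move=> i j; rewrite nbrs_link // => /or3P[/adj //| |] /andP[/eqP-> /eqP->]; split=> //.
by rewrite (v3_sym vG).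
Qed.

Lemma embedding_add_edge x y : x < order P -> y < order P ->
  cadj (f x) (f y) -> embedding (add_edge P (x, y)) f.
Proof. by move=> lt_x lt_y xy; rewrite /add_edge /= lt_y; apply: embedding_link. Qed.

End Embedding.

Lemma embedding_add_new (G : cgraph) P (f : nat -> G) x y : v3 G -> embedding P f ->
  x < order P -> cadj (f x) y -> (forall i, i < order P -> f i != y) ->
  embedding (add_edge P (x, order P)) (fun i => if i == order P then y else f i).
Proof.
move=> vG [inj adj [c col_f]] lt_x xy fresh; rewrite /add_edge /= ltnn.
have lt i : i < (order P).+1 -> i != order P -> i < order P by rewrite ltnS ltn_neqAle => -> ->.
have order_add : order (add_vertex P (~~ colour P x)) = (order P).+1 by apply: size_rcons.
apply: embedding_link; rewrite ?order_add ?ltnS ?(ltnW lt_x) ?leqnn ?eqxx ?(ltn_eqF lt_x) //.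
split; rewrite order_add.
- move=> i j; rewrite !inE => lt_i lt_j.
  have [->|iN] := eqVneq i (order P); have [->|jN] := eqVneq j (order P) => // eq_f.
  + by move: (fresh j (lt _ lt_j jN)); rewrite eq_f eqxx.
  + by move: (fresh i (lt _ lt_i iN)); rewrite eq_f eqxx.
  + by apply: inj eq_f; apply: lt.
- move=> i j; rewrite /nbrs nth_rcons -/(order P).
  case: ltnP => [lt_i|_]; last by case: ifP.
  by move=> /adj[lt_j ij]; rewrite (ltn_eqF lt_i) (ltn_eqF lt_j) ltnS (ltnW lt_j).
- exists c => i lt_i; rewrite /colour nth_rcons -/(order P).
  have [->|iN] := eqVneq i (order P); last by rewrite lt //; apply: col_f; apply: lt.
  by rewrite ltnn /= (v3_col vG xy) (col_f _ lt_x) addbN.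
Qed.

(** * Growing a pattern *)

Definition third_nbrs (P : pattern) (x : nat) : seq nat :=
  flatten [seq flatten [seq nbrs P b | b <- nbrs P a] | a <- nbrs P x].

(* Unless it is already present, the edge [x y] would give a vertex a fourth neighbour or
   close a square. *)
Definition blocked (P : pattern) (x y : nat) : bool :=
  [|| full P x, full P y && (x \notin nbrs P y) | y \in third_nbrs P x].

Definition growth (P : pattern) (x : nat) : seq (nat * nat) :=
  rcons [seq (x, y) | y <- iota 0 (order P) &
           [&& colour P y != colour P x, y \notin nbrs P x & ~~ blocked P x y]]
        (x, order P).

Lemma blocked_nadj (G : cgraph) P (f : nat -> G) x y : v3 G -> embedding P f ->
  x < order P -> y < order P -> y \notin nbrs P x -> blocked P x y -> ~~ cadj (f x) (f y).
Proof.
move=> vG f_emb lt_x lt_y xy /or3P[full_x|/andP[full_y yx]|].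
- by rewrite (full_embedding_adj vG f_emb).
- by rewrite (v3_sym vG) (full_embedding_adj vG f_emb).
case/flatten_mapP => a xa /flatten_mapP[b ab yb]; apply/negP => adj_xy.
have [_ adj _] := f_emb; have [lt_a adj_xa] := adj x a xa.
have [lt_b adj_ab] := adj a b ab; have [_ adj_by] := adj b y yb.
have xNb : f x != f b by rewrite (embedding_eq f_emb) //; apply: contraNneq xy => ->.
have /eqP := v3_square_free vG xNb adj_xa adj_ab adj_by (etrans (v3_sym vG _ _) adj_xy).
by rewrite (embedding_eq f_emb) // => /eqP eq_ay; rewrite -eq_ay xa in xy.
Qed.

Lemma growth_sound (G : cgraph) P x : v3 G -> x < order P -> size (nbrs P x) < 3 ->
  {in growth P x, forall d, excluded G (add_edge P d)} -> excluded G P.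
Proof.
move=> vG lt_x size_x excl f f_emb.
have [|y xy yN] := @v3_new_nbr _ vG (f x) (map f (nbrs P x)); first by rewrite size_map.
have [/mapP[j + eq_y] | fresh] := boolP (y \in map f (iota 0 (order P))).
  rewrite mem_iota => /= lt_j; rewrite eq_y in xy yN.
  rewrite (embedding_mem f_emb lt_j (nbrs_lt f_emb x)) in yN.
  apply: (excl (x, j) _ f); last exact: embedding_add_edge.
  rewrite mem_rcons inE; apply/orP; right; apply/map_f.
  rewrite mem_filter mem_iota lt_j yN !andbT /=; apply/andP; split; last first.
    by apply: contraL xy; apply: blocked_nadj.
  have [_ _ [c col_f]] := f_emb; have := v3_col vG xy; rewrite (col_f _ lt_x) (col_f _ lt_j).
  by case: c {col_f} (colour P x) (colour P j) => [] [] [].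
apply: (excl (x, order P) _ _ (embedding_add_new vG f_emb lt_x xy _)).
  by rewrite mem_rcons mem_head.
by move=> i lt_i; apply: contraNneq fresh => <-; apply: map_f; rewrite mem_iota.
Qed.

(** * Reductions of a pattern *)

(* The pairs [(x, y)] whose adjacency would join some [(a, b)] of [ms] by a path
   [a x y b] that avoids [u] and [v]. *)
Definition detours (P : pattern) (u v : nat) (ms : seq (nat * nat)) : seq (nat * nat) :=
  flatten [seq [seq (x, y) | x <- rem u (nbrs P p.1), y <- rem v (nbrs P p.2)] | p <- ms].

Definition matched_pairs (P : pattern) (u v : nat) (bs : seq nat) : seq (nat * nat) :=
  zip (rem v (nbrs P u)) bs.

(* The reduction by [u] and [v] that matches the remaining neighbours of [u] with [bs] in
   this order is determined, and the known edges do not make it inadmissible. *)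
Definition locally_admissible (P : pattern) (u v : nat) (bs : seq nat) : bool :=
  let us := rem v (nbrs P u) in let vs := rem u (nbrs P v) in
  let ms := matched_pairs P u v bs in
  [&& full P u && full P v, colour P u != colour P v, (size us == size vs) && perm_eq bs vs,
      all (full P) (us ++ vs), all (fun d => d.2 \notin nbrs P d.1) (detours P u v ms) &
      all2rel (fun p q => [|| p.1 == q.1, q.2 \notin nbrs P p.1 | p.2 \notin nbrs P q.1]) ms].

Definition open_detours (P : pattern) (u v : nat) (bs : seq nat) : seq (nat * nat) :=
  [seq d <- detours P u v (matched_pairs P u v bs) | ~~ blocked P d.1 d.2].

Section LocallyAdmissible.
Variables (G : cgraph) (P : pattern) (u v : nat) (bs : seq nat) (f : nat -> G).
Hypotheses (vG : v3 G) (f_emb : embedding P f) (adm : locally_admissible P u v bs).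

Let ms := matched_pairs P u v bs.

Let r : rel G := fun x y => (x, y) \in [seq (f d.1, f d.2) | d <- ms].

Lemma locally_admissible_full : full P u /\ full P v.
Proof. by case/and5P: adm => /andP[]. Qed.

Lemma locally_admissible_perm :
  size (rem v (nbrs P u)) = size bs /\ perm_eq bs (rem u (nbrs P v)).
Proof.
by case/and5P: adm => _ _ /andP[/eqP size_us bs_vs] _ _; rewrite size_us (perm_size bs_vs).
Qed.

Lemma locally_admissible_col : ccol (f v) = ~~ ccol (f u).
Proof.
have [/full_lt lt_u /full_lt lt_v] := locally_admissible_full; have [_ _ [c col_f]] := f_emb.
case/and5P: adm => _ + _ _ _; rewrite !col_f //.
by case: c {col_f} (colour P u) (colour P v) => [] [] [].
Qed.

Lemma matched_pairs_matching : is_matching (N(f u) :\ f v) (N(f v) :\ f u) r.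
Proof.
have [full_u full_v] := locally_admissible_full; have [size_bs bs_vs] := locally_admissible_perm.
have lt_rem i j : all (gtn (order P)) (rem j (nbrs P i)).
  by apply/allP => k /mem_rem; apply/allP/(nbrs_lt f_emb).
have zip_ms : zip (map f (rem v (nbrs P u))) (map f bs) = [seq (f d.1, f d.2) | d <- ms].
  rewrite -zip_map (map_comp f fst) (map_comp f snd) -/(unzip1 ms) -/(unzip2 ms).
  by rewrite unzip1_zip ?unzip2_zip // size_bs.
rewrite -(full_nbhdD1 vG f_emb full_u (full_lt full_v)).
rewrite -(full_nbhdD1 vG f_emb full_v (full_lt full_u)).
have -> : [set y in map f (rem u (nbrs P v))] = [set y in map f bs].
  by apply/setP => y; rewrite !inE (perm_mem (perm_map f bs_vs)).
rewrite /r -zip_ms; apply: zip_matching; last by rewrite !size_map size_bs.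
- by rewrite (embedding_uniq f_emb) ?lt_rem // rem_uniq //; case/andP: full_u.
- have lt_bs : all (gtn (order P)) bs by rewrite (perm_all _ bs_vs) lt_rem.
  by rewrite (embedding_uniq f_emb) // (perm_uniq bs_vs) rem_uniq //; case/andP: full_v.
Qed.

Lemma matched_pairs_full a b : (a, b) \in ms -> full P a /\ full P b.
Proof.
have [size_bs bs_vs] := locally_admissible_perm.
case/and5P: adm => _ _ _ + _; rewrite all_cat => /andP[/allP full_us /allP full_vs] ab.
split; [apply: full_us | apply: full_vs; rewrite -(perm_mem bs_vs)].
  by rewrite -(unzip1_zip (eq_leq size_bs)) (map_f fst ab).
by rewrite -(unzip2_zip (eq_leq (esym size_bs))) (map_f snd ab).
Qed.

Lemma matched_pairs_admissible :
  {in open_detours P u v bs, forall d, excluded G (add_edge P d)} -> admissible (f u) (f v) r.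
Proof.
move=> excl; have [/full_lt lt_u /full_lt lt_v] := locally_admissible_full.
case/and5P: adm => _ _ _ _ /andP[/allP no_detour /allrelP no_crossing].
split=> [x y s t /mapP[[a b] ab [-> ->]] |].
  have [full_a full_b] := matched_pairs_full ab.
  rewrite -(full_nbhdD1 vG f_emb full_a lt_u) -(full_nbhdD1 vG f_emb full_b lt_v) !inE.
  case/mapP => i ai -> /mapP[j bj ->]; apply/negP => ij.
  have det : (i, j) \in detours P u v ms.
    by apply/flatten_mapP; exists (a, b); last exact: allpairs_f.
  have lt_i : i < order P := allP (nbrs_lt f_emb a) i (mem_rem ai).
  have lt_j : j < order P := allP (nbrs_lt f_emb b) j (mem_rem bj).
  have [ij_blocked | ij_open] := boolP (blocked P i j).
    by have := blocked_nadj vG f_emb lt_i lt_j (no_detour _ det) ij_blocked; rewrite ij.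
  apply: (excl (i, j) _ f); last exact: embedding_add_edge.
  by rewrite mem_filter det andbT.
move=> x y x' y' /mapP[[a b] ab [-> ->]] /mapP[[a' b'] ab' [-> ->]].
have [full_a full_b] := matched_pairs_full ab; have [full_a' full_b'] := matched_pairs_full ab'.
rewrite !(full_embedding_adj vG f_emb) ?full_lt // => adj_ab' adj_a'b.
by have := no_crossing _ _ ab ab'; rewrite /= adj_ab' adj_a'b !orbF => /eqP->.
Qed.

End LocallyAdmissible.

Lemma open_detours_sound (G : cgraph) P u v bs :
  v3 G -> gconnected G -> irreducible G -> locally_admissible P u v bs ->
  {in open_detours P u v bs, forall d, excluded G (add_edge P d)} -> excluded G P.
Proof.
move=> vG con_G irr_G adm excl f f_emb.
exact: (irreducible_not_admissible vG con_G irr_G (locally_admissible_col f_emb adm)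
         (matched_pairs_matching vG f_emb adm) (matched_pairs_admissible vG f_emb adm excl)).
Qed.

(** * Subpatterns *)

Definition subpattern (Q P : pattern) (g : seq nat) : bool :=
  [&& size g == order Q, uniq g, all (gtn (order P)) g,
      all (fun i => all (fun j => (j < order Q) && (nth 0 g j \in nbrs P (nth 0 g i)))
                        (nbrs Q i)) (iota 0 (order Q)) &
      constant [seq colour Q i (+) colour P (nth 0 g i) | i <- iota 0 (order Q)]].

Definition extend_maps (Q P : pattern) (gs : seq (seq nat)) (i : nat) : seq (seq nat) :=
  let earlier := [seq j <- nbrs Q i | j < i] in
  [seq rcons g y | g <- gs,
     y <- [seq y <- nbrs P (nth 0 g (head 0 earlier)) |
             (y \notin g) & all (fun j => y \in nbrs P (nth 0 g j)) earlier]].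

(* The search for a copy of [Q] whose vertex 0 is [x] only succeeds if every other vertex of
   [Q] has a neighbour that precedes it. *)
Definition contains (P Q : pattern) (x : nat) : bool :=
  has (subpattern Q P) (foldl (extend_maps Q P) [:: [:: x]] (iota 1 (order Q).-1)).

Lemma subpattern_sound (G : cgraph) Q P g : subpattern Q P g -> excluded G Q -> excluded G P.
Proof.
case/and5P => /eqP size_g uniq_g /allP lt_g /allP adj_g /constantP-/(_ false)[c0 col_g] exclQ.
move=> f [inj adj [c col_f]].
have lt i : i < order Q -> nth 0 g i < order P.
  by move=> lt_i; apply: lt_g; rewrite mem_nth // size_g.
apply: (exclQ (fun i => f (nth 0 g i))); split.
- move=> i j lt_i lt_j /inj; rewrite !inE => /(_ (lt _ lt_i) (lt _ lt_j)) /eqP.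
  by rewrite nth_uniq ?size_g // => /eqP.
- move=> i j ij; have lt_i : i < order Q.
    by rewrite ltnNge; apply: contraL ij => ge_i; rewrite /nbrs nth_default.
  have /adj_g/allP/(_ j ij)/andP[lt_j /adj[]] // : i \in iota 0 (order Q) by rewrite mem_iota.
- exists (c (+) c0) => i lt_i; rewrite col_f ?lt // -addbA; congr (_ (+) _).
  have := congr1 (fun s => nth false s i) col_g.
  rewrite nth_nseq size_map size_iota lt_i (nth_map 0) ?size_iota // nth_iota // add0n => <-.
  by case: (colour Q i); case: (colour P _).
Qed.

Lemma contains_sound (G : cgraph) P Q x : contains P Q x -> excluded G Q -> excluded G P.
Proof. by case/hasP => g _; apply: subpattern_sound. Qed.

(** * The Heawood and the Pappus graph *)

(* [lcf_adj] on numbers instead of elements of ['I_n], whose enumeration does not compute. *)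
Definition lcf_nat (n : nat) (off : nat -> nat) (i j : nat) : bool :=
  [|| j == (i + 1) %% n, i == (j + 1) %% n, j == (i + off i) %% n | i == (j + off j) %% n].

Definition lcf_pattern (n : nat) (off : nat -> nat) : pattern :=
  [seq (odd i, [seq j <- iota 0 n | lcf_nat n off i j]) | i <- iota 0 n].

Definition heawood_pattern : pattern := lcf_pattern 14 (fun i => if odd i then 9 else 5).
Definition pappus_pattern : pattern := lcf_pattern 18 pappus_off.

(* The image of a pattern whose vertices are all full is closed under adjacency. *)
Lemma full_embedding_iso (G : cgraph) P n (e : rel 'I_n) (f : nat -> G) :
  v3 G -> gconnected G -> 0 < n -> order P = n -> (forall i : 'I_n, full P i) ->
  (forall i j : 'I_n, (val j \in nbrs P i) = e i j) -> embedding P f -> isomorphic_to G e.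
Proof.
move=> vG con_G n_gt0 order_P full_P nbrs_P f_emb; have [inj _ _] := f_emb.
pose h (i : 'I_n) := f i; have lt (i : 'I_n) : i < order P by rewrite order_P.
have h_inj : injective h by move=> i j /(inj _ _ (lt i) (lt j))/val_inj.
have h_adj i j : cadj (h i) (h j) = e i j by rewrite (full_embedding_adj vG f_emb) ?nbrs_P.
have h_surj x : x \in codom h.
  rewrite -(closed_connect (e := @cadj G) (a := mem (codom h)) _ (con_G.2 (h (Ordinal n_gt0)) x)).
    exact: codom_f.
  apply: (intro_closed (sym_connect_sym (v3_sym vG))) => y z yz /codomP[i eq_y].
  move: yz; rewrite eq_y (full_adj vG f_emb) // => /mapP[j ij ->].
  have lt_j : j < n by rewrite -order_P; apply: (allP (nbrs_lt f_emb i)).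
  exact: (codom_f h (Ordinal lt_j)).
have [g hK gK] : bijective h.
  apply: (inj_card_bij h_inj); rewrite -(card_codom h_inj).
  by apply/subset_leq_card/subsetP => x _; apply: h_surj.
by exists g; split=> [|x y]; [exists h | rewrite -h_adj !gK].
Qed.

Lemma lcf_pattern_excluded (G : cgraph) n off : v3 G -> gconnected G ->
  0 < n -> all (full (lcf_pattern n off)) (iota 0 n) ->
  ~ isomorphic_to G (@lcf_adj n off) -> excluded G (lcf_pattern n off).
Proof.
move=> vG con_G n_gt0 /allP full_lcf not_iso f f_emb; apply: not_iso.
apply: (full_embedding_iso vG con_G n_gt0 _ _ _ f_emb).
- by rewrite /order size_map size_iota.
- by move=> i; apply: full_lcf; rewrite mem_iota ltn_ord.
- move=> i j; rewrite /nbrs (nth_map 0) ?size_iota // nth_iota //= add0n.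
  by rewrite mem_filter mem_iota add0n ltn_ord !andbT.
Qed.

(** * The search tree *)

(* The instructions form a search tree in preorder. [Grow] and [Reduce] replace the
   pattern on top of the stack by the cases of a new neighbour, resp. of an inadmissible
   reduction. [Keep] asks for the pattern on top to be memorised once its cases are settled;
   [Use k x] closes a pattern that contains the [k]-th memorised one, rooted at [x]. *)
Inductive instr :=
  | Grow of nat
  | Reduce of nat & nat & seq nat
  | Keep
  | Use of nat & nat.

Inductive task := Exclude of pattern | Memorise of pattern.

Definition cases (P : pattern) (ds : seq (nat * nat)) : seq task :=
  [seq Exclude (add_edge P d) | d <- ds].

Fixpoint settle (ts : seq task) (memo : seq pattern) : seq task * seq pattern :=
  if ts is Memorise P :: ts then settle ts (rcons memo P) else (ts, memo).

Fixpoint run (prog : seq instr) (ts : seq task) (memo : seq pattern) : bool :=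
  let: (ts, memo) := settle ts memo in
  match prog, ts with
  | [::], [::] => true
  | i :: prog, Exclude P :: ts =>
    match i with
    | Grow x =>
        [&& x < order P, size (nbrs P x) < 3 & run prog (cases P (growth P x) ++ ts) memo]
    | Reduce u v bs =>
        locally_admissible P u v bs && run prog (cases P (open_detours P u v bs) ++ ts) memo
    | Keep => run prog (Exclude P :: Memorise P :: ts) memo
    | Use k x => [&& k < size memo, contains P (nth [::] memo k) x & run prog ts memo]
    end
  | _, _ => false
  end.

Section RunSound.
Variable G : cgraph.

Fixpoint holds (ts : seq task) : Prop :=
  match ts with
  | [::] => True
  | Exclude P :: ts => excluded G P /\ holds ts
  | Memorise P :: ts => excluded G P -> holds ts
  end.

Lemma holds_cases P ds ts : holds (cases P ds ++ ts) ->
  {in ds, forall d, excluded G (add_edge P d)} /\ holds ts.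
Proof.
elim: ds => [|d ds IH] //= [excl_d /IH[excl_ds holds_ts]]; split=> // d'.
by rewrite inE => /predU1P[-> //|/excl_ds].
Qed.

Lemma settle_sound ts memo : {in memo, forall P, excluded G P} ->
  ({in (settle ts memo).2, forall P, excluded G P} -> holds (settle ts memo).1) -> holds ts.
Proof.
elim: ts memo => [|[P|P] ts IH] memo excl_memo //=; first exact.
move=> sound excl_P; apply: IH sound => Q.
by rewrite mem_rcons inE => /predU1P[-> //|/excl_memo].
Qed.

Hypotheses (vG : v3 G) (con_G : gconnected G) (irr_G : irreducible G).

Lemma run_sound prog ts memo :
  {in memo, forall P, excluded G P} -> run prog ts memo -> holds ts.
Proof.
elim: prog ts memo => [|i prog IH] ts memo excl_memo /=;
  have := @settle_sound ts memo excl_memo;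
  case: (settle ts memo) => [ts' memo'] /= sound run_ts; apply: sound => {}excl_memo.
  by case: ts' run_ts.
case: ts' run_ts => [//|[P|//] ts']; case: i => [x|u v bs||k x].
- case/and3P=> lt_x size_x /(IH _ _ excl_memo)/holds_cases[excl_cases holds_ts]; split=> //.
  exact: growth_sound excl_cases.
- case/andP=> adm /(IH _ _ excl_memo)/holds_cases[excl_cases holds_ts]; split=> //.
  exact: open_detours_sound excl_cases.
- by move/(IH _ _ excl_memo) => /= [excl_P /(_ excl_P)].
- case/and3P=> lt_k sub /(IH _ _ excl_memo) holds_ts; split=> //.
  exact: contains_sound sub (excl_memo _ (mem_nth _ lt_k)).
Qed.

End RunSound.

Section Certificate.

Local Notation G := Grow.
Local Notation R := Reduce.
Local Notation K := Keep.
Local Notation U := Use.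

(* Found by a computer search for a small tree. *)
Definition certificate : seq instr := [::
G 0; G 0; G 0; G 1; G 1; G 2; G 2; G 3; G 3; G 4; G 4; G 5; G 5; R 0 1 [::4;5]; K; G 9; K; G 8; K;
G 8; K; G 10; K; G 6; K; G 11; K; G 7; U 0 0; G 13; G 14; K; G 14; G 15; G 16; G 16;
R 5 14 [::7;16;15]; G 16; G 16; G 14; U 2 0; G 19; G 19; R 5 14 [::7;19;16]; G 7; U 3 0; G 7;
U 3 0; G 13; U 3 1; G 14; K; G 14; G 15; G 16; G 16; R 7 2 [::6;0]; G 19; G 19;
R 0 15 [::19;14;7]; U 4 0; G 14; U 4 0; U 4 0; G 15; U 4 0; G 15; U 4 0; G 16; U 4 0; G 16; U 4 0;
R 7 2 [::6;0]; G 14; G 14; G 7; K; G 7; U 5 0; G 12; K; G 13; K; G 15; G 16; R 5 14 [::15;6;16];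
G 18; G 18; R 15 10 [::8;6;4]; G 15; U 6 1; G 16; K; G 16; R 6 14 [::16;15]; G 16; U 7 0;
R 6 14 [::16;15]; U 8 0; G 18; K; G 18; G 13; K; G 15; U 8 0; G 19; R 15 2 [::6;7;0]; G 20; G 20;
R 15 2 [::6;7;0]; U 9 0; G 20; U 8 0; K; G 20; G 17; K; G 15; R 5 17 [::7;15;18];
R 5 17 [::7;15;18]; U 10 0; G 22; K; G 22; R 5 17 [::7;22;18]; G 22; U 11 0; R 5 17 [::7;22;18];
G 20; U 8 0; U 12 0; G 17; U 12 1; U 12 1; G 19; K; G 19; R 18 2 [::7;0;6]; U 13 0; G 19; U 13 0;
U 13 0; R 18 2 [::7;0;6]; G 18; U 14 0; G 13; U 14 1; U 14 1; G 15; K; G 17; U 8 0; G 15; K; G 16;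
K; G 16; R 6 14 [::15;16]; G 16; U 15 0; R 6 14 [::15;16]; U 16 0; G 23; K; G 23;
R 15 2 [::7;6;0]; G 23; U 17 0; R 15 2 [::7;6;0]; K; G 15; U 18 0; G 19; U 18 1; G 22; K; G 22;
R 15 1 [::4;0;5]; G 22; U 19 0; R 15 1 [::4;0;5]; U 20 0; G 15; U 18 0; U 20 0; U 20 0; G 19;
U 20 0; U 18 1; G 19; U 20 0; U 18 1; G 16; U 18 0; U 20 0; G 16; U 18 0; U 20 0;
R 6 14 [::16;15]; K; G 7; R 6 2 [::0;7]; U 21 0; G 7; U 21 0; U 22 0; U 21 0; R 6 2 [::0;7];
U 23 0; G 11; U 23 0; U 23 0; G 6; U 23 0; U 23 0; G 6; U 23 0; U 23 0; G 7; U 23 0; U 23 0; G 7;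
U 23 0; U 23 0; R 0 2 [::7;6]; G 10; K; G 11; U 24 1; R 4 3 [::0;9;8]; G 7; K; G 7; U 24 2;
U 24 2; U 25 0; G 7; U 25 0; U 25 0; U 24 2; U 26 0; G 12; U 26 0; U 26 0; K; G 15; G 11; K; G 6;
U 26 1; U 26 3; U 26 4; U 26 4; U 27 0; G 6; K; G 13; U 27 5; G 6; K; G 14; U 27 8;
R 6 1 [::5;0;4]; U 28 5; G 19; K; G 19; R 6 1 [::5;0;4]; G 19; U 29 0; R 6 1 [::5;0;4]; U 30 0; K;
G 16; U 27 15; G 6; U 30 0; U 30 0; G 7; U 30 0; U 30 0; G 7; U 30 0; U 30 0; R 0 2 [::7;6]; G 6;
U 30 0; U 30 0; U 31 0; G 7; U 30 0; U 30 0; U 31 0; G 7; U 30 0; U 30 0; U 31 0; R 0 2 [::7;6];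
G 15; K; G 15; R 0 10 [::15;4;8]; K; G 13; K; G 6; K; G 7; K; G 14; R 8 10 [::4;15];
R 8 10 [::4;15]; G 14; U 33 1; R 6 10 [::4;8;15]; G 7; U 32 1; U 34 4; G 14; K; G 14;
R 8 10 [::4;15]; G 14; U 35 0; R 8 10 [::4;15]; U 32 3; G 7; U 32 1; U 36 11; G 6; K; G 6; K;
G 17; R 15 1 [::4;0;5]; R 15 1 [::4;0;5]; G 14; U 36 9; U 37 1; R 8 10 [::4;15]; K; G 6; U 38 0;
G 17; R 15 1 [::4;0;5]; R 15 1 [::4;0;5]; G 6; U 38 0; U 39 0; G 19; U 38 11; U 39 11; G 19;
U 38 11; U 39 11; R 7 2 [::0;6]; U 40 0; G 15; U 41 0; R 0 10 [::15;4;8]; K; G 7; U 32 3; U 32 1;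
U 41 1; U 41 1; G 13; U 41 3; G 13; U 41 3; G 6; U 41 1; K; G 6; U 41 1; G 14; U 41 0; K; G 14;
U 41 0; R 8 10 [::4;15]; U 42 0; G 14; U 41 0; U 42 0; U 42 0; R 8 10 [::4;15]; U 43 0; G 6;
U 41 1; U 43 0; U 43 0; G 14; U 41 0; U 43 3; U 43 3; G 14; U 41 0; U 43 1; U 43 1;
R 8 10 [::4;15]; U 44 0; U 45 0; G 8; U 45 0; U 45 0; R 0 3 [::9;8]; U 45 3; U 45 3; U 45 3;
U 45 3; U 46 0; G 11; U 46 1; U 46 1; R 0 1 [::5;4]; K; G 8; U 46 0; G 13; U 46 1; U 46 1; K;
G 15; G 10; K; G 10; G 12; U 46 0; K; G 12; K; G 6; G 14; R 6 13 [::5;8;15]; K; G 7; G 16;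
R 8 2 [::0;6;7]; R 8 2 [::0;6;7]; G 16; R 8 2 [::0;6;7]; R 8 2 [::0;6;7]; U 47 4; K; G 16;
R 6 13 [::5;8;15]; R 6 3 [::0;8;9]; U 48 4; G 19; G 19; R 6 3 [::0;8;9]; U 48 5; U 48 0; G 6; K;
G 14; K; G 7; U 49 1; G 17; R 7 1 [::0;4;5]; R 7 1 [::0;4;5]; G 20; K; G 20; R 7 1 [::0;4;5];
G 20; U 50 0; R 7 1 [::0;4;5]; R 6 13 [::5;8;15]; G 18; U 51 11; R 5 10 [::6;4;18]; U 51 1; K;
G 16; R 6 3 [::0;8;9]; R 6 11 [::4;9;15]; G 18; U 46 4; R 4 10 [::6;18]; R 6 3 [::0;8;9];
R 6 13 [::5;8;15]; K; G 7; U 53 0; U 52 0; G 17; R 6 1 [::0;5;4]; R 6 1 [::0;5;4]; G 7; U 53 0;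
U 52 0; U 54 0; G 20; K; G 20; R 6 1 [::0;5;4]; G 20; U 55 0; R 6 1 [::0;5;4]; U 56 4; G 12;
U 46 0; U 56 0; U 56 4; G 6; G 7; K; G 14; U 56 0; U 56 0; U 56 0; K; G 7; U 57 0;
R 5 2 [::6;0;7]; G 7; U 57 0; U 58 0; R 5 2 [::6;0;7]; K; G 7; K; G 16; U 56 0; U 56 0; U 56 0; K;
G 7; U 59 0; R 4 2 [::6;0;7]; G 7; U 59 0; U 60 0; R 4 2 [::6;0;7]; U 61 4; G 21; K; G 21;
R 6 1 [::4;0;5]; U 62 0; G 21; U 62 0; U 62 0; R 6 1 [::4;0;5]; U 63 0; G 10; U 63 0; U 63 0;
G 12; U 63 0; U 63 0; U 63 4; U 63 4; G 12; U 63 0; U 63 0; U 63 4; U 63 4; G 6; U 63 0; U 63 0;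
K; G 6; U 63 0; U 63 0; G 7; U 63 0; U 63 0; G 7; U 63 0; U 63 0; R 0 2 [::7;6]; G 6; U 63 0;
U 63 0; U 64 0; G 7; U 63 0; U 63 0; U 64 0; G 7; U 63 0; U 63 0; U 64 0; R 0 2 [::7;6]; G 15; K;
G 15; K; G 12; K; R 5 11 [::4;9;15]; K; G 16; K; R 15 11 [::4;9]; K; G 6; K; G 14; U 1 0; G 17;
G 18; K; G 18; G 19; G 20; G 20; R 18 2 [::6;0;7]; G 20; G 20; G 18; U 66 0; G 23; G 23;
R 18 2 [::6;0;7]; G 14; U 67 1; G 14; U 67 1; G 17; U 67 1; G 18; K; G 18; G 19; G 20; G 20;
R 0 14 [::20;9;19]; G 23; G 23; R 19 1 [::0;4;5]; U 68 0; G 18; U 68 0; U 68 0; G 19; U 68 4;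
G 19; U 68 4; G 20; U 68 4; G 20; U 68 4; R 0 14 [::20;9;19]; R 8 11 [::4;9;15]; U 69 0; U 69 0;
R 8 3 [::0;9]; U 70 13; G 10; U 71 5; U 71 0; G 10; U 71 4; U 71 0; G 18; U 71 3; U 71 4; G 18;
U 71 3; U 71 4; G 19; U 71 3; U 71 4; G 19; U 71 3; U 71 4; R 0 10 [::19;4;18]; U 72 0;
R 5 1 [::4;0]; R 5 3 [::9;0;8]; G 16; U 72 0; U 72 0; U 72 13; R 0 11 [::15;4;9]; K; G 10; K;
G 12; G 6; U 73 4; U 65 1; G 14; U 65 1; U 73 0; G 14; U 65 1; U 73 0; R 9 3 [::0;8]; U 46 0;
R 5 3 [::9;0;8]; U 73 0; G 12; U 74 4; U 46 0; U 46 1; R 5 1 [::4;0]; U 75 0; U 76 0; G 15;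
U 76 0; U 76 0; R 0 11 [::15;4;9]; K; G 10; U 76 0; R 4 11 [::9;15]; R 0 11 [::4;9;15]; G 6;
U 76 3; U 46 0; U 76 3; U 76 3; U 76 3; U 65 1; U 77 0; U 78 0; U 78 1; U 78 1; U 79 0; U 79 0;
U 79 0; U 79 0; U 79 0; U 79 0; U 79 0
].

End Certificate.

Lemma certificate_run :
  run certificate [:: Exclude (add_vertex [::] true)] [:: heawood_pattern; pappus_pattern].
Proof. by vm_compute. Qed.

Lemma irreducible_heawood_or_pappus (G : cgraph) :
  v3 G -> gconnected G -> irreducible G ->
  isomorphic_to G heawood_adj \/ isomorphic_to G pappus_adj.
Proof.
move=> vG con_G irr_G; apply: NNPP => /not_or_and[not_heawood not_pappus].
have excl : {in [:: heawood_pattern; pappus_pattern], forall P, excluded G P}.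
  by move=> P; rewrite !inE => /orP[] /eqP->; apply: lcf_pattern_excluded.
have [no_vertex _] := run_sound vG con_G irr_G excl certificate_run.
have /card_gt0P[x _] := con_G.1.
apply: (no_vertex (fun=> x)); split; first by case=> [|i] [|j].
  by case=> [|[|i]].
by exists (~~ ccol x); case=> //= _; case: (ccol x).
Qed.

Lemma reduction_step_card_lt (G G' : cgraph) : reduction_step G G' -> #|G'| < #|G|.
Proof.
case=> u [v [_ [_ _ _ _ [f [f_inj f_avoids _ _ _]]]]].
rewrite -(card_codom f_inj); apply/proper_card/properP; split; first exact/subsetP.
by exists u => //; apply/codomP => -[x eq_u]; have [] := f_avoids x; rewrite -eq_u eqxx.
Qed.

Theorem theorem2 (G : cgraph) :
  v3 G -> gconnected G ->
  exists H : cgraph, reduces_to G H /\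
    (isomorphic_to H heawood_adj \/ isomorphic_to H pappus_adj).
Proof.
have [n] := ubnP #|G|; elim: n G => // n IH G ltGn vG con_G.
have [irr_G | red_G] := classic (irreducible G).
  by exists G; split; [exact: red_refl | exact: irreducible_heawood_or_pappus].
apply: NNPP => none; apply: red_G => G' step vG' con_G'; apply: none.
have [|H [red iso]] := IH G' _ vG' con_G'.
  exact: leq_trans (reduction_step_card_lt step) ltGn.
by exists H; split=> //; apply: red_step red.
Qed.
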